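(* Let $m\in\{1,2\}$, $\lambda=\frac{m+2}{m+1}m^2$, $\mu=\frac{3m+2}{2(m+1)-m^2}m^2$, let $A,B,A_1,B_1>0$, and put $T=\frac{2(m+2)}{A}$. Let $(u,v)$ be a classical solution on $[0,T)$ of the system (R0) $$\lambda u_t=xvu_x+\tfrac{m^2}{2}vu,$$ $$\lambda\Bigl(v+\tfrac{1}{\mu+m}xv_x\Bigr)_t=\tfrac{\mu-m^2}{\mu+m}v^2-\tfrac{\mu}{\mu+m}u^2+\tfrac{\mu+1-m}{\mu+m}xvv_x-\tfrac{1}{\mu+m}x^2\bigl(v_x^2-vv_{xx}\bigr),$$ with initial data $u(0,x)=Bx^2e^{-B_1x^2}$, $v(0,x)=Ae^{-A_1x^2}$. Then the apex trace $u_c(t):=u(t,0)$, $v_c(t):=v(t,0)$ blows up in finite time at $T=\frac{2(m+2)}{A}$. More precisely, $$u_c(t)\equiv0,\qquad v_c(t)=\frac{2(m+2)A}{2(m+2)-At}=\frac{2(m+2)}{T-t}\qquad\text{for }0\le t<T,$$ and in particular $v_c(t)\to+\infty$ as $t\uparrow T$.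
   Context: Here $u=u(t,x)$, $v=v(t,x)$ are real-valued functions of time $t$ and the axis variable $x$ (including $x=0$). ''Classical'' means that all derivatives appearing in the equations exist and are continuous up to $x=0$. *)

(* Defs.v *)
From HB Require Import structures.
From mathcomp Require Import all_boot all_order all_algebra.
From mathcomp Require Import all_classical all_reals all_analysis.
Set Implicit Arguments.
Unset Strict Implicit.
Unset Printing Implicit Defensive.
Import Order.TTheory GRing.Theory Num.Theory.
Import numFieldNormedType.Exports.
Local Open Scope classical_set_scope.
Local Open Scope ring_scope.

(* Derivative of f at a relative to D: an ordinary derivative at interior
   points of D, a one-sided one at an end point belonging to D.  Values of f
   outside D are irrelevant when a \in D. *)
Definition diff_quotient {R : realType} (f : R -> R) (a y : R) : R :=
  (f y - f a) / (y - a).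

Definition derivable_in {R : realType} (D : set R) (f : R -> R) (a : R) : Prop :=
  cvg (diff_quotient f a y @[y --> within D a^']).

Definition derive_in {R : realType} (D : set R) (f : R -> R) (a : R) : R :=
  lim (diff_quotient f a y @[y --> within D a^']).

Section Spacetime.
Context {R : realType}.
Implicit Types (T t x : R) (f u v : R -> R -> R).

Definition times T : set R := [set t | 0 <= t < T].
Definition axis : set R := [set x | 0 <= x].

(* The spatial domain is the closed half line; a solution on the whole line
   restricts to one here, with one-sided x-derivatives at the apex x = 0. *)
(* Functions are applied as f t x. *)
Definition dt T f t x : R := derive_in (times T) (f ^~ x) t.
Definition dx f t x : R := derive_in axis (f t) x.

Definition has_dt T f : Prop :=
  forall t x, times T t -> axis x -> derivable_in (times T) (f ^~ x) t.
Definition has_dx T f : Prop :=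
  forall t x, times T t -> axis x -> derivable_in axis (f t) x.

Definition jointly_continuous T f : Prop :=
  {within times T `*` axis, continuous (fun p : R * R => f p.1 p.2)}.

(* v + x v_x / (mu + m), whose time derivative appears in the second equation *)
Definition transported (m : nat) (mu : R) v t x : R :=
  v t x + 1 / (mu + m%:R) * x * dx v t x.

Definition classical (m : nat) (mu : R) T u v : Prop :=
  [/\ has_dt T u /\ has_dx T u,
      [/\ has_dx T v, has_dx T (dx v) & has_dt T (transported m mu v)],
      [/\ jointly_continuous T u, jointly_continuous T (dt T u)
        & jointly_continuous T (dx u)],
      [/\ jointly_continuous T v, jointly_continuous T (dx v)
        & jointly_continuous T (dx (dx v))]
    & jointly_continuous T (dt T (transported m mu v))].

Definition solves_R0 (m : nat) (lambda mu : R) T u v : Prop :=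
  forall t x, times T t -> axis x ->
    lambda * dt T u t x =
      x * v t x * dx u t x + m%:R ^+ 2 / 2 * v t x * u t x
    /\
    lambda * dt T (transported m mu v) t x =
      (mu - m%:R ^+ 2) / (mu + m%:R) * v t x ^+ 2
      - mu / (mu + m%:R) * u t x ^+ 2
      + (mu + 1 - m%:R) / (mu + m%:R) * x * v t x * dx v t x
      - 1 / (mu + m%:R) * x ^+ 2 * (dx v t x ^+ 2 - v t x * dx (dx v) t x).

End Spacetime.

(* Main.v *)
Require Import Defs.
From HB Require Import structures.
From mathcomp Require Import all_boot all_order all_algebra.
From mathcomp Require Import all_classical all_reals all_analysis.
From mathcomp Require Import ring lra.
Import Order.TTheory GRing.Theory Num.Theory.
Import numFieldNormedType.Exports.
Local Open Scope classical_set_scope.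
Local Open Scope ring_scope.

(* At the apex [x = 0] every term carrying a factor [x] vanishes, so the traces
   solve [lambda u' = m^2/2 v u] and [v' = v^2/(2(m+2)) - c u^2].  The first
   equation is linear in [u] with zero initial value, hence [u = 0]; then
   [(T - t) v - 2(m+2)] also solves a linear equation with zero initial value. *)

(* With [K] an upper bound of [a], the function [f^2 exp(-2Kt)] is nonnegative
   and nonincreasing, and it starts at [0]. *)
Lemma linear_ode_zero (R : realType) (f a : R -> R) (b : R) :
  0 <= b ->
  {within `[0, b], continuous f} -> {within `[0, b], continuous a} ->
  (forall t : R, 0 < t < b -> is_derive t 1 f (a t * f t)) ->
  f 0 = 0 -> f b = 0.
Proof.
move=> b0 cf ca df f0.
have [c _ aK] := EVT_max b0 ca.
set K := a c in aK.
pose E (t : R) : R := expR (- (2 * K) * t).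
have dE (t : R) : is_derive t 1 E (- (2 * K) * E t).
  rewrite mulrC; apply: (@is_derive1_comp _ expR (fun t : R => - (2 * K) * t)).
  apply: is_derive_eq.
  exact: mulr1.
pose w := (f ^+ 2) * E.
have dw (t : R) : 0 < t < b -> is_derive t 1 w (2 * (a t - K) * (f t ^+ 2 * E t)).
  move=> tb; have ? := df _ tb; have ? := dE t.
  apply: is_derive_eq.
  rewrite /GRing.scale /= !fctE; ring.
have wb : w b <= w 0.
  apply: (@ler0_derive1_nincr _ w 0 b) => //.
  - by move=> t; rewrite in_itv /= => /dw[].
  - move=> t; rewrite in_itv /= => tb; rewrite derive1E.
    have [_ ->] := dw _ tb.
    have atK : a t <= K.
      by apply: aK; rewrite in_itv /=; case/andP: tb => /ltW -> /ltW ->.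
    apply: mulr_le0_ge0; first by rewrite mulr_ge0_le0 // subr_le0.
    by apply: mulr_ge0; [exact: sqr_ge0 | exact: expR_ge0].
  - have cE : {within `[0, b], continuous E}.
      apply: continuous_subspaceT => x.
      by apply/differentiable_continuous/derivable1_diffP; have [] := dE x.
    by move=> t; apply: continuousM; [apply: continuousM; exact: cf | exact: cE].
move: wb; rewrite /w /= !fctE f0 expr0n /= mul0r.
rewrite pmulr_lle0 ?expR_gt0 // => fb.
by apply/eqP; rewrite -sqrf_eq0 eq_le fb sqr_ge0.
Qed.

(** Near an interior point, restricting to [D] does not change the punctured neighbourhood filter,
    so the relative limit is two-sided. Interior points suffice later: [linear_ode_zero] asks for
    derivatives only on the open interval. *)
Lemma is_derive_derive_in (R : realType) (D : set R) (f : R -> R) (t : R) :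
  D° t -> derivable_in D f t -> is_derive t 1 f (derive_in D f t).
Proof.
move=> Dt; rewrite /derivable_in /derive_in.
have -> : within D t^' = t^'.
  rewrite /dnbhs; apply/seteqP; split => P; rewrite /within /=.
    by apply: filterS2 Dt => y Dy h /h; exact.
  by apply: filterS => y h /h.
set l := lim _ => cl; apply/is_derive1_caratheodory.
(* Carathéodory's slope function: the difference quotient, extended by its limit [l] at [t]. *)
exists (fun z => if z == t then l else diff_quotient f t z); split.
- move=> z; case: eqVneq => [->|zt]; first by rewrite !subrr mulr0.
  by rewrite /diff_quotient divfK // subr_eq0.
- apply/continuous_withinNx; rewrite eqxx.
  apply: cvg_trans cl; apply: near_eq_cvg.
  by near=> y; rewrite ifN //; near: y; exact: nbhs_dnbhs_neq.
- by rewrite eqxx.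
Unshelve. all: by end_near.
Qed.

Section apex.
Context {R : realType}.
Implicit Types (T b t : R) (w : R -> R -> R).

(** The trace is [w] composed with [s |-> (s, 0)], which sends [[0, b]] into the domain of joint
    continuity because [b < T]. *)
Lemma jointly_continuous_apex T b w : b < T -> jointly_continuous T w ->
  {within `[0, b], continuous (w ^~ 0)}.
Proof.
move=> bT /subspace_continuousP cw; apply/subspace_continuousP => t.
rewrite /= in_itv /= => /andP[t0 tb].
have Dt : (times T `*` axis) (t, 0 : R).
  by split; rewrite /times /axis /= ?t0 ?(le_lt_trans tb).
apply: cvg_trans (cw _ Dt).
apply: (@cvg_comp _ _ _ (fun s : R => (s, 0 : R)) (fun p => w p.1 p.2)); last exact: cvg_id.
have h : (s, 0 : R) @[s --> t] --> (t, 0 : R).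
  apply: (@cvg_pair _ _ _ _ (nbhs t) (nbhs (0 : R)));
    [exact: cvg_id | exact: cvg_cst].
move=> P PD; rewrite /= /within /=.
have : \forall s \near t, (times T `*` axis) (s, 0 : R) -> P (s, 0) := h _ PD.
apply: filterS => s Ps; rewrite in_itv /= => /andP[s0 sb]; apply: Ps.
by split; rewrite /times /axis /= ?s0 ?(le_lt_trans sb).
Qed.

Lemma is_derive_dt T t w : 0 < t < T -> derivable_in (times T) (w ^~ 0) t ->
  is_derive t 1 (w ^~ 0) (dt T w t 0).
Proof.
move=> tT; apply: is_derive_derive_in.
have tI : t \in `]0, T[ by rewrite in_itv.
apply: filterS (near_in_itvoo tI) => s.
by rewrite in_itv /times /= => /andP[/ltW -> ->].
Qed.

(** Thanks to this, the left side of the second equation at the apex involves the time derivative of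
    [v] alone. *)
Lemma transported_apex m (mu : R) v : transported m mu v ^~ 0 = v ^~ 0.
Proof. by apply/funext => t; rewrite /transported mulr0 mul0r addr0. Qed.

End apex.

Theorem theorem4p2 (R : realType) (m : nat) (hm : m = 1%N \/ m = 2%N)
  (lambda mu : R)
  (hlambda : lambda = (m%:R + 2) / (m%:R + 1) * m%:R ^+ 2)
  (hmu : mu = (3 * m%:R + 2) / (2 * (m%:R + 1) - m%:R ^+ 2) * m%:R ^+ 2)
  (A B A1 B1 : R) (hA : 0 < A) (hB : 0 < B) (hA1 : 0 < A1) (hB1 : 0 < B1)
  (T : R) (hT : T = 2 * (m%:R + 2) / A)
  (u v : R -> R -> R)
  (huv : classical m mu T u v)
  (hR0 : solves_R0 m lambda mu T u v)
  (hu0 : forall x : R, 0 <= x -> u 0 x = B * x ^+ 2 * expR (- (B1 * x ^+ 2)))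
  (hv0 : forall x : R, 0 <= x -> v 0 x = A * expR (- (A1 * x ^+ 2))) :
  (forall t : R, 0 <= t < T ->
     [/\ u t 0 = 0,
         v t 0 = 2 * (m%:R + 2) * A / (2 * (m%:R + 2) - A * t)
       & v t 0 = 2 * (m%:R + 2) / (T - t)])
  /\ v t 0 @[t --> T^'-] --> +oo.
Proof.
case: huv => [[hu _] [_ _ hv] [cu _ _] [cv _ _] _].
have mN0 : m%:R + 2 != 0 :> R by rewrite -natrD pnatr_eq0 addn2.
have T0 : 0 < T by rewrite hT divr_gt0 // mulr_gt0 // ltr_wpDl.
have la0 : lambda != 0.
  rewrite hlambda; apply: mulf_neq0; last first.
    by case: hm => ->; rewrite expf_neq0 ?pnatr_eq0.
  by rewrite mulf_neq0 ?invr_eq0 // natr1 pnatr_eq0.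
have axis0 : axis (0 : R) by rewrite /axis /=.
have timesT t : 0 <= t < T -> times T t by [].
have u0 (t : R) : 0 <= t < T -> u t 0 = 0.
  move=> /andP[t0 tT].
  (* The first equation at [x = 0], divided by [lambda], reads [u' = k v u]. *)
  pose k : R := m%:R ^+ 2 / 2 / lambda.
  apply: (@linear_ode_zero R (u ^~ 0) (fun s => k * v s 0) t t0).
  - exact: jointly_continuous_apex cu.
  - move=> s; apply: (@continuousM _ _ (cst k)); first exact: cvg_cst.
    exact: (jointly_continuous_apex _ _ _ tT cv).
  - move=> s /andP[s0 st].
    have sT : 0 <= s < T by rewrite (ltW s0) (lt_trans st).
    have ds : is_derive s 1 (u ^~ 0) (dt T u s 0).
      by apply: is_derive_dt; [rewrite s0 (lt_trans st) | exact: hu].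
    apply: is_derive_eq.
    have [e _] := hR0 _ _ (timesT _ sT) axis0.
    apply: (mulfI la0); rewrite e !mul0r add0r /k.
    by field.
  - by rewrite hu0 // expr0n /= mulr0 mul0r.
have dv (t : R) : 0 < t < T ->
    is_derive t 1 (v ^~ 0) (v t 0 ^+ 2 / (2 * (m%:R + 2))).
  move=> /andP[t0 tT].
  have tT' : 0 <= t < T by rewrite ltW.
  have ds : is_derive t 1 (transported m mu v ^~ 0) (dt T (transported m mu v) t 0).
    by apply: is_derive_dt; [rewrite t0 | exact: hv].
  rewrite transported_apex in ds.
  apply: is_derive_eq.
  have [_ e] := hR0 _ _ (timesT _ tT') axis0.
  apply: (mulfI la0); rewrite e (u0 _ tT') expr0n /= !(mulr0, mul0r) !(addr0, subr0).
  (* With [u = 0] the right side is [(mu - m^2) / (mu + m) * v^2]. Here [(mu - m^2) / (mu + m) = m^2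
     / (2 (m + 1))], and division by [lambda] leaves [1 / (2 (m + 2))]. Fixing [m] makes all
     denominators numerical. *)
  rewrite hlambda hmu.
  by case: hm => ->; field; lra.
have vE (t : R) : 0 <= t < T -> v t 0 = 2 * (m%:R + 2) / (T - t).
  move=> /andP[t0 tT].
  set M := 2 * (m%:R + 2) in hT dv *.
  have M0 : M != 0 by rewrite mulf_neq0.
  (* [v' = v^2 / M] gives [g' = (v / M) g]. *)
  pose g (s : R) := (T - s) * v s 0 - M.
  suff : g t = 0.
    rewrite /g => /eqP; rewrite subr_eq0 => /eqP <-.
    by rewrite mulrAC mulfV ?mul1r // subr_eq0 gt_eqF.
  apply: (@linear_ode_zero R g (fun s => M^-1 * v s 0) t t0).
  - have cv0 := jointly_continuous_apex _ _ _ tT cv.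
    have c1 : {within `[0, t], continuous (fun s : R => T - s)}.
      apply: continuous_subspaceT => s.
      by apply: cvgB; [exact: cvg_cst | exact: cvg_id].
    move=> s; apply: cvgB; last exact: cvg_cst.
    by apply: cvgM; [exact: c1 | exact: cv0].
  - move=> s; apply: (@continuousM _ _ (cst M^-1)); first exact: cvg_cst.
    exact: (jointly_continuous_apex _ _ _ tT cv).
  - move=> s /andP[s0 st].
    have ds := dv s; rewrite s0 (lt_trans st tT) in ds; have {}ds := ds isT.
    rewrite /g; apply: is_derive_eq.
    rewrite /GRing.scale /=; by field.
  (* Since [v 0 0 = A], the initial value is [g 0 = T * A - M], which vanishes exactly for
     [T = M / A]. *)
  - rewrite /g hv0 // expr0n /= mulr0 oppr0 expR0 addr0 mulr1 hT.
    by rewrite divfK ?subrr // gt_eqF.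
split.
  move=> t /[dup] tT /andP[t0 ltT]; split; [exact: u0 | | exact: vE].
  have A0 : A != 0 by rewrite gt_eqF.
  have D0 : 2 * (m%:R + 2) - A * t != 0.
    move: ltT; rewrite hT ltr_pdivlMr // mulrC -subr_gt0 => D_gt0.
    by rewrite gt_eqF.
  rewrite (vE _ tT) hT; field.
  by rewrite A0 D0.
have M_gt0 : 0 < 2 * (m%:R + 2) :> R by rewrite mulr_gt0 // ltr_wpDl.
have near_vE : \forall t \near T^'-, v t 0 = 2 * (m%:R + 2) / (T - t).
  near=> t; apply: vE; apply/andP; split; last by near: t; exact: nbhs_left_lt.
  by near: t; exact: nbhs_left_ge.
(* Divergence to [+oo] amounts to positivity near [T] together with [1 / v] tending to [0]; by the
   explicit formula [1 / v] is the affine function [(T - t) / (2 (m + 2))]. *)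
apply/gtr0_cvgV0.
  near=> t; rewrite (near near_vE t) // divr_gt0 // subr_gt0.
  by near: t; exact: nbhs_left_lt.
have : (T - t) / (2 * (m%:R + 2)) @[t --> T^'-] --> (T - T) / (2 * (m%:R + 2)).
  apply: cvgM; last exact: cvg_cst.
  by apply: cvgB; [exact: cvg_cst | apply: cvg_at_left_filter; exact: cvg_id].
rewrite subrr mul0r; apply: cvg_trans; apply: near_eq_cvg; near=> t.
transitivity (v t 0)^-1; last by [].
by rewrite (near near_vE t) // invf_div.
Unshelve. all: by end_near.
Qed.
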